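(* Let $q$ be a power of an odd prime and $L(X)=a_1X^{q^2}+a_0X\in\mathbb{F}_{q^4}[X]$ with $a_1\neq0$. Then $\mathrm{Tr}_{q^4/q}(L(X)/X)$ has no root in $\mathbb{F}_{q^4}^*$ if and only if $a_1^{q^2+1}$ is a square of an element of $\mathbb{F}_q^*$ (in particular lies in $\mathbb{F}_q^*$) and $\mathrm{Tr}_{q^4/q}(a_0)=0$.
   Context: $\mathrm{Tr}_{q^4/q}$ denotes the trace map from $\mathbb{F}_{q^4}$ to $\mathbb{F}_q$. *)

(* Defs.v *)
From HB Require Import structures.
From mathcomp Require Import all_boot all_order all_fingroup all_algebra all_solvable all_field.
Set Implicit Arguments. Unset Strict Implicit. Unset Printing Implicit Defensive.
Import GRing.Theory.
Local Open Scope ring_scope.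

(* The trace of the extension L / K, as an element of the copy of K in L.
   Every finite extension of a finite field is a splitting field; the
   (non-canonical) FinSplittingFieldType supplies the structure that the Galois
   trace needs, on the same carrier and with the same operations as L. *)
Definition trace (K : finFieldType) (L : fieldExtType K) (x : L) : L :=
  let S := FinSplittingFieldType K L in
  galTrace (1%VS : {vspace S}) (fullv : {vspace S}) (x : S).

(* Main.v *)
Require Import Defs.
From HB Require Import structures.
From mathcomp Require Import all_boot all_order all_fingroup all_algebra all_solvable all_field.
From mathcomp Require Import ring zify.
Set Implicit Arguments. Unset Strict Implicit. Unset Printing Implicit Defensive.
Import GRing.Theory.
Local Open Scope ring_scope.

(* As x runs over the nonzero elements, z = a1 x^(q^2-1) runs over the solutions
   of z z^(q^2) = N := a1^(q^2+1) (Hilbert 90), and Tr z = w + w^q with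
   w = z + z^(q^2).  The values w that occur are exactly those w in F_(q^2) for
   which w^2 - 4N is zero or a nonsquare of F_(q^2).  Hence there is no root iff
   w^2 - 4N is a nonzero square whenever w + w^q = -Tr a0.  Such w form a line
   over F_q, and taking norms to F_q gives a quartic G, up to a square factor
   u^4 + B u^2 + C u + D, with G(u)^m = 1 for all u in F_q, m = (q-1)/2.
   Writing G^m = 1 + (X^q - X) h and differentiating twice (2m = -1 in F_q)
   produces an identity between polynomials of degree at most 4 modulo
   X^q - X; it forces G to be a square, without any recourse to the Hasse-Weil
   bound, and this gives Tr a0 = 0 and N in F_q. *)

(** * Roots of unity and squares in a finite field *)

Lemma finField_prim_root (F : finFieldType) :
  exists w : F, (#|F|.-1).-primitive_root w.
Proof.
have F_gt1 : (1 < #|F|)%N := finNzRing_gt1 F.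
pose rs := [seq x <- enum F | x != 0].
suff /hasP[w _ w_prim] : has (#|F|.-1).-primitive_root rs by exists w.
apply: has_prim_root; first by lia.
- apply/allP=> x; rewrite mem_filter => /andP[x_neq0 _].
  apply/unity_rootP/(mulfI x_neq0); rewrite mulr1 -exprS prednK ?expf_card //.
  exact: ltnW.
- by rewrite filter_uniq ?enum_uniq.
- by rewrite -(cardC1 (0 : F)) cardE /enum_mem /rs enumT.
Qed.

(** Half of Euler's criterion: writing [x = w ^+ i] with [w] a generator, the hypothesis forces [i]
    to be even. *)
Lemma finField_sqrP (F : finFieldType) (x : F) : odd #|F| ->
  x ^+ (#|F|.-1./2) = 1 -> exists y, x = y ^+ 2.
Proof.
have F_gt1 : (1 < #|F|)%N := finNzRing_gt1 F.
move=> F_odd x_half; have [w w_prim] := finField_prim_root F.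
have F1E : #|F|.-1 = (#|F|.-1./2 * 2)%N by lia.
have /(prim_rootP w_prim)[i xE] : x ^+ #|F|.-1 = 1.
  by rewrite F1E exprM x_half expr1n.
have := x_half; rewrite xE -exprM => /eqP.
rewrite -(prim_order_dvd w_prim) {1}F1E mulnC dvdn_pmul2r; last by lia.
by case/dvdnP=> j ->; exists (w ^+ j); rewrite exprM.
Qed.

(** A primitive root of unity of order [j * 2] works: its [j]-th power squares to 1 but is not 1. *)
Lemma finField_exp_eqN1 (F : finFieldType) (j : nat) : (0 < j)%N ->
  (j * 2 %| #|F|.-1)%N -> exists x : F, x ^+ j = -1.
Proof.
move=> j_gt0 dvd_j; have [w w_prim] := finField_prim_root F.
have y_prim := dvdn_prim_root w_prim dvd_j.
set y := w ^+ _ in y_prim; exists y; apply/eqP.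
have /eqP := prim_expr_order y_prim; rewrite exprM -[X in _ == X](expr1n _ 2) eqf_sqr.
rewrite -(prim_order_dvd y_prim) => /orP[/dvdn_leq|//]; lia.
Qed.

Lemma natr_card_finField (F : finFieldType) : (#|F|)%:R = 0 :> F.
Proof.
have := expg_cardG (in_setT (1 : F)); rewrite FinRing.zmodXgE cardsT; exact.
Qed.

Lemma finField_nat2_neq0 (F : finFieldType) : odd #|F| -> (2 : F) != 0.
Proof.
move=> F_odd; apply: contra_eq_neq (natr_card_finField F) => two0.
by rewrite -(odd_double_half #|F|) F_odd -muln2 natrD natrM two0 mulr0 addr0 oner_neq0.
Qed.

(** * Quartics taking only nonzero square values *)

(** The first identity is the derivative of [G ^+ m = 1 + Q * h] times [2 * G], simplified by
    [2 * m = -1]. Differentiating it again and eliminating [h] between the two gives the second,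
    whose left side has small degree when [G] and [r] do. *)
Lemma wronskian_identity (R : idomainType) (m : nat) (G Q h : {poly R})
    (r := 2 * G * h^`() + G^`() * h) :
    (m * 2).+1%:R = 0 :> R -> Q^`() = -1 -> G ^+ m = 1 + Q * h ->
  2 * G * h - G^`() = Q * r /\
  G^`() ^+ 2 + 4 * G * r - 2 * G * G^`()^`() = Q * (2 * G * r^`() - G^`() * r).
Proof.
move=> m2 dQ GmE.
have m2P : (m * 2)%:R = -1 :> {poly R}.
  by apply/eqP; rewrite -subr_eq0 opprK natr1 -polyC_natr m2.
have e1 : 2 * G * h - G^`() = Q * r.
  have dE : G^`() * G ^+ m * (m * 2)%:R = 2 * G * (Q * h^`() - h).
    have := congr1 (fun p => 2 * G * p^`()) GmE.
    rewrite /= deriv_exp derivD derivM dQ derivC add0r [in RHS]addrC mulN1r => <-.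
    case: (m) => [|n]; first by rewrite mul0n !mulr0.
    rewrite exprS natrM -mulr_natr; ring.
  rewrite m2P GmE in dE.
  have -> : Q * r = 2 * G * (Q * h^`() - h) + 2 * G * h + Q * G^`() * h.
    by rewrite /r; ring.
  by rewrite -dE; ring.
split=> //.
have e2 : 2 * (G^`() * h) + 2 * G * h^`() - G^`()^`() = Q * r^`() - r.
  have := congr1 (@deriv R) e1.
  rewrite derivB (derivM Q) dQ -mulrA mulr_natl derivMn derivM => e.
  rewrite (_ : Q * _ - r = -1 * r + Q * r^`()); last by ring.
  by rewrite -e; ring.
have rE : 2 * G * h^`() = r - G^`() * h by rewrite /r; ring.
have e3 : G^`() * h + 2 * r - G^`()^`() = Q * r^`().
  by rewrite -[RHS](subrK r) -e2 rE; ring.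
have -> : Q * (2 * G * r^`() - G^`() * r) =
  2 * G * (Q * r^`()) - G^`() * (Q * r) by ring.
by rewrite -e3 -e1; ring.
Qed.

(** The conclusion says that the quartic is the square of [X^2 + B/2]. It comes from comparing
    degrees in [wronskian_identity] with [Q = X^q - X]. *)
Lemma quartic_of_sqr_values (F : finFieldType) (B C D : F) : odd #|F| ->
    (forall u : F, (u ^+ 4 + B * u ^+ 2 + C * u + D) ^+ (#|F|.-1./2) = 1) ->
  C = 0 /\ B ^+ 2 = 4 * D.
Proof.
move=> F_odd sqr_val.
have F_gt1 : (1 < #|F|)%N := finNzRing_gt1 F.
have F0 := natr_card_finField F.
have two_neq0 := finField_nat2_neq0 F_odd.
have mul2K (x : F) : 2 * x = 0 -> x = 0.
  by move/eqP; rewrite mulf_eq0 (negPf two_neq0) => /eqP.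
have [F3|F_gt3] : #|F| = 3%N \/ (3 < #|F|)%N.
  by case: (ltngtP #|F| 3) => //; [lia|right|left].
  (* For [q = 3] the exponent is 1, so the values at 0, 1, -1 all equal 1 and determine the
     coefficients. The degree bounds used afterwards need [q > 3]. *)
  have := sqr_val 0; have := sqr_val 1; have := sqr_val (-1).
  rewrite F3 /= !expr1 in F0 * => vN v1 v0.
  have C0 : C = 0.
    apply: mul2K; transitivity (1 - 1 : F); last exact: subrr.
    by rewrite -[X in X - _]v1 -[X in _ - X]vN; ring.
  have D1 : D = 1 by rewrite -v0; ring.
  have BE : B = -1.
    have -> : B = (1 ^+ 4 + B * 1 ^+ 2 + C * 1 + D) - C - 1 - D by ring.
    by rewrite v1 C0 D1; ring.
  split=> //; rewrite BE D1 -[LHS]addr0 -F0; ring.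
set m := #|F|.-1./2 in sqr_val; set q := #|F| in F_odd F0 F_gt1 F_gt3 m sqr_val *.
pose G := 'X^4 + B%:P * 'X^2 + C%:P * 'X + D%:P : {poly F}.
pose Q := 'X^q - 'X : {poly F}.
have sizeQ : size Q = q.+1.
  by rewrite size_polyDl size_polyXn // size_polyN size_polyX.
have monicQ : Q \is monic.
  by rewrite monicE lead_coefDl ?lead_coefXn // size_polyXn size_polyN size_polyX.
pose G0 := B%:P * 'X^2 + C%:P * 'X + D%:P : {poly F}.
have GE : G = 'X^4 + G0 by rewrite /G /G0 !addrA.
have sizeG0 : (size G0 < size ('X^4 : {poly F}))%N.
  rewrite size_polyXn ltnS (@leq_trans 3) //; apply/leq_sizeP=> -[|[|[|j]]] // _.
  by rewrite !coefE /=; ring.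
have sizeG : size G = 5%N by rewrite GE size_polyDl // size_polyXn.
have monicG : G \is monic by rewrite monicE GE lead_coefDl // lead_coefXn.
(* [Q] is the product of all ['X - u], and every [u] is a root of [G ^+ m - 1]. *)
have [h GmE] : exists h, G ^+ m = 1 + Q * h.
  have /dvdpP[h hE] : Q %| G ^+ m - 1.
    rewrite /Q finField_genPoly -big_enum /=.
    apply: uniq_roots_dvdp; last by rewrite uniq_rootsE enum_uniq.
    apply/allP=> u _; rewrite rootE hornerD hornerN hornerC horner_exp.
    have -> : G.[u] = u ^+ 4 + B * u ^+ 2 + C * u + D by rewrite /G !hornerE.
    by rewrite sqr_val subrr.
  by exists h; rewrite [Q * h]mulrC -hE addrC subrK.
have dQ : Q^`() = -1.
  by rewrite derivB derivX derivXn -mulr_natr -polyC_natr F0 mulr0 sub0r.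
have m2E : (m * 2).+1%:R = 0 :> F by rewrite -F0; congr (_%:R); lia.
have [e1 e2] := wronskian_identity m2E dQ GmE.
set r := 2 * G * h^`() + _ in e1 e2; clearbody r.
have mE : (m * 2).+1 = q by rewrite /m; lia.
have sizeGm : size (G ^+ m) = (q.-1 * 2).+1.
  have := size_exp G m; rewrite sizeG => sE.
  have : (0 < size (G ^+ m))%N by rewrite size_poly_gt0 monic_neq0 ?monic_exp.
  case: (size _) sE => // n /= -> _; lia.
have QhE : Q * h = G ^+ m - 1 by rewrite GmE addrC addKr.
have size1 : (size (- 1 : {poly F})%R < size (G ^+ m))%N.
  by rewrite size_polyN size_poly1 sizeGm; lia.
have sizeQh : size (Q * h) = (q.-1 * 2).+1 by rewrite QhE size_polyDl.
have monich : h \is monic.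
  have : lead_coef (Q * h) = 1.
    by rewrite QhE lead_coefDl //; apply/monicP; rewrite monic_exp.
  by rewrite lead_coefM (monicP monicQ) mul1r monicE => ->.
have sizeh : size h = q.-1.
  move: sizeQh; rewrite size_monicM ?monic_neq0 // sizeQ; lia.
have monicGh : G * h \is monic by rewrite monicMl.
have sizeGh : size (G * h) = q.+3.
  by rewrite size_monicM ?monic_neq0 // sizeG sizeh; lia.
have size_dG : (size G^`() <= 4)%N.
  by rewrite -ltnS -sizeG lt_size_deriv ?monic_neq0.
(* [h] has degree [q - 2], so [Q * r] has degree at most [q + 2]. *)
have sizer : (size r <= 3)%N.
  have [->|r_neq0] := eqVneq r 0; first by rewrite size_poly0.
  have : (size (Q * r)%R <= q.+3)%N.
    rewrite -e1 (leq_trans (size_polyD _ _)) // geq_max size_polyN.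
    rewrite (leq_trans size_dG) ?andbT; last by lia.
    rewrite -mulrA mulr_natl -scaler_nat (leq_trans (size_scale_leq _ _)) //.
    by rewrite sizeGh.
  by rewrite size_monicM // sizeQ; lia.
have coefQ (p : {poly F}) i : (0 < i)%N -> (size p <= i.+1)%N ->
    (Q * p)`_(q + i) = p`_i.
  move=> i_gt0 sp; rewrite mulrBl coefB coefXnM coefXM ifN; last by lia.
  rewrite ifN; last by lia.
  by rewrite addKn [X in _ - X]nth_default ?subr0 // (leq_trans sp) //; lia.
have r2 : r`_2 = 2.
  have := @coefQ r 2 isT sizer; rewrite -e1 coefB [X in _ - X]nth_default; last first.
    by rewrite (leq_trans size_dG) //; lia.
  rewrite subr0 -mulrA mulr_natl coefMn => <-.
  have := monicP monicGh; rewrite lead_coefE sizeGh /= addn2 => ->.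
  by [].
pose b := r`_1; pose c := r`_0.
have rE : r = 2 * 'X^2 + b%:P * 'X + c%:P.
  rewrite /b /c; apply/polyP=> -[|[|[|i]]].
  - by rewrite mulr_natl !coefE /=; ring.
  - by rewrite mulr_natl !coefE /=; ring.
  - by rewrite mulr_natl !coefE /= r2; ring.
  - rewrite nth_default; last by rewrite (leq_trans sizer).
    by rewrite mulr_natl !coefE /=; ring.
have dGE : G^`() = 4 * 'X^3 + 2 * B%:P * 'X + C%:P by rewrite /G !derivE; ring.
have ddGE : G^`()^`() = 12 * 'X^2 + 2 * B%:P.
  by rewrite dGE !mulr_natl !derivE; ring.
have drE : r^`() = 4 * 'X + b%:P by rewrite rE !mulr_natl !derivE; ring.
set P := 2 * G * r^`() - _ in e2; set S := (X in X = _) in e2.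
have PE : P = (-2 * b)%:P * 'X^4 + (4 * B - 4 * c)%:P * 'X^3 + (6 * C)%:P * 'X^2
    + (8 * D + C * b - 2 * B * c)%:P * 'X + (2 * D * b - C * c)%:P.
  by rewrite /P drE dGE rE /G; ring.
have SE : S = (4 * b)%:P * 'X^5 + (4 * c - 4 * B)%:P * 'X^4
    + (4 * b * B - 8 * C)%:P * 'X^3 + (4 * B * c - 16 * D + 4 * b * C)%:P * 'X^2
    + (4 * C * c + 4 * b * D)%:P * 'X + (C ^+ 2 + 4 * D * c - 4 * B * D)%:P.
  by rewrite /S ddGE dGE rE /G; ring.
have sizeP : (size P <= 5)%N.
  apply/leq_sizeP=> -[|[|[|[|[|j]]]]] // _.
  by rewrite PE !coefE /=; ring.
(* [S] has degree at most 5, below [q + 4], so the coefficient [-2 * b] of [Q * P] in degree [q + 4]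
   vanishes. *)
have b0 : b = 0.
  have : S`_(q + 4) = 0.
    apply: (leq_sizeP _ 6 _); last by lia.
    apply/leq_sizeP=> -[|[|[|[|[|[|j]]]]]] // _.
    by rewrite SE !coefE /=; ring.
  rewrite e2 coefQ // PE !coefE /= => bE; apply: mul2K.
  by rewrite -[RHS]oppr0 -[in RHS]bE; ring.
(* Once [b = 0], [S] has degree at most 4, less than [q], yet it is a multiple of [Q]. Its
   coefficients in degrees 4, 3, 2 then give the claim. *)
have S0 : S = 0.
  have sizeS : (size S < size Q)%N.
    rewrite sizeQ ltnS (@leq_trans 5) //; last by lia.
    apply/leq_sizeP=> -[|[|[|[|[|j]]]]] // _.
    by rewrite SE b0 !coefE /=; ring.
  have [P0|P_neq0] := eqVneq P 0; first by rewrite e2 P0 mulr0.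
  have := P_neq0; rewrite -size_poly_gt0; move: sizeS.
  by rewrite e2 size_monicM // sizeQ; case: (size P) => // n; lia.
have coefS i : S`_i = 0 by rewrite S0 coef0.
have cE : c = B.
  apply/subr0_eq/mul2K/mul2K; have := coefS 4%N.
  by rewrite SE !coefE /= => <-; ring.
have C0 : C = 0.
  apply/mul2K/mul2K/mul2K; have := coefS 3%N.
  by rewrite SE b0 !coefE /= => SC; rewrite -[RHS]oppr0 -[in RHS]SC; ring.
split=> //; apply/subr0_eq/mul2K/mul2K; have := coefS 2%N.
by rewrite SE b0 cE !coefE /= => <-; ring.
Qed.

(** * Frobenius and trace of a finite extension *)

Section FiniteExtension.

Variables (K : finFieldType) (L : fieldExtType K).
Local Notation q := #|K|.

Lemma frobenius_rmorphism :
  exists s : {rmorphism L -> L}, forall x, s x = x ^+ q.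
Proof.
have [p p_prime pcharK] := finPcharP K.
have q_nat : [pchar L].-nat q.
  have := pprimeChar_pgroup pcharK; rewrite /pgroup cardsT.
  apply: sub_in_pnat => r _ r_p; rewrite pchar_lalg.
  by rewrite (eqP r_p).
have zm : zmod_morphism (fun x : L => x ^+ q).
  by move=> x y; rewrite exprDn_pchar // exprNn_pchar.
have mm : monoid_morphism (fun x : L => x ^+ q).
  by split=> [|x y]; rewrite ?expr1n ?exprMn.
pose s : {rmorphism L -> L} := HB.pack (fun x : L => x ^+ q)
  (GRing.isZmodMorphism.Build L L (fun x : L => x ^+ q) zm)
  (GRing.isMonoidMorphism.Build L L (fun x : L => x ^+ q) mm).
by exists s.
Qed.

Lemma frobenius_fixed (x : L) : x ^+ q = x -> exists b : K, x = in_alg L b.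
Proof.
move=> /eqP xq; have : x \in 1%VS.
  by rewrite (Fermat's_little_theorem 1%AS) dimv1 expn1.
by case/vlineP=> b ->; exists b.
Qed.

Lemma expf_card_ext (x : L) : x ^+ (q ^ \dim {:L}) = x.
Proof. by apply/eqP; rewrite -(Fermat's_little_theorem {:L}%AS) memvf. Qed.

Lemma card_FinFieldExt : #|FinFieldExtType L| = (q ^ \dim {:L})%N.
Proof. by rewrite -(@card_vspace K (finvect_type L) _ fullv) card_vspacef. Qed.

(** The Galois group is cyclic, generated by the Frobenius, of order the degree; the Galois sum is
    reindexed by powers of this generator. *)
Lemma trace_frobenius (x : L) :
  trace x = \sum_(i < \dim {:L}) x ^+ (q ^ i).
Proof.
rewrite /trace /galTrace.
set S := FinSplittingFieldType K L.
have [a a_gen aE] := @finField_galois_generator K S 1%AS {:S}%AS (sub1v _).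
have aX i (y : S) : (a ^+ i)%g y = y ^+ (q ^ i).
  elim: i y => [|i IHi] y; first by rewrite expg0 gal_id.
  by rewrite expgSr galM ?memvf // IHi aE ?memvf // dimv1 expn1 -exprM -expnSr.
have a_ord : #[a]%g = \dim {:L}.
  rewrite orderE -(eqP a_gen) -galois_dim ?finField_galois ?sub1v //.
  by rewrite dimv1 divn1.
have -> : 'Gal({:S} / 1%VS)%g = [set (a ^+ val i)%g | i in 'I_(\dim {:L})].
  apply/setP=> y; rewrite [in LHS](eqP a_gen); apply/idP/imsetP=> [|[i _ ->]].
    case/cyclePmin=> i; rewrite a_ord => lt_i ->.
    by exists (Ordinal lt_i).
  exact: mem_cycle.
rewrite big_imset /=; first by apply: eq_bigr => i _; rewrite aX.
move=> i j _ _ /eqP; rewrite eq_expg_mod_order a_ord !modn_small // => /eqP.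
exact: val_inj.
Qed.

End FiniteExtension.

(** * Nonvanishing of the trace when the norm is a square *)

(** If the trace vanished, [s] would negate [w = z + s (s z)], hence fix [d^2 = w^2 - 4 b^2] for
    [d = z - s (s z)]. Then [s d] is [d] or [- d], so [s (s d) = d]; but [s (s d) = - d], whence
    [d = 0]. So [z] is [b] or [- b], fixed by [s], and its trace [4 z] is nonzero. *)
Lemma sqr_norm_trace_neq0 (L : fieldType) (s : {rmorphism L -> L}) (z b : L) :
    (2 : L) != 0 -> (forall x, s (s (s (s x))) = x) -> s b = b -> b != 0 ->
    z * s (s z) = b ^+ 2 ->
  z + s z + s (s z) + s (s (s z)) != 0.
Proof.
move=> two_neq0 s4 sb b_neq0 normz; apply: contra_neq b_neq0 => trz0.
have mul2K (x : L) : 2 * x = 0 -> x = 0.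
  by move/eqP; rewrite mulf_eq0 (negPf two_neq0) => /eqP.
have swE : s (z + s (s z)) = - (z + s (s z)).
  by apply/eqP; rewrite -addr_eq0 -trz0 !rmorphD; apply/eqP; ring.
have dE : (z - s (s z)) ^+ 2 = (z + s (s z)) ^+ 2 - 4 * b ^+ 2.
  by rewrite -normz; ring.
have s2d : s (s (z - s (s z))) = - (z - s (s z)).
  by rewrite !rmorphB s4; ring.
have d0 : z - s (s z) = 0.
  have : s (z - s (s z)) ^+ 2 = (z - s (s z)) ^+ 2.
    rewrite -rmorphXn dE rmorphB rmorphXn swE rmorphM rmorphXn sb rmorph_nat.
    by ring.
  move=> /eqP; rewrite eqf_sqr => /orP[] /eqP sd; apply: mul2K.
    by move: s2d; rewrite sd sd => sd2; rewrite [LHS]mulr_natl mulr2n {1}sd2 addNr.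
  move: s2d; rewrite sd rmorphN sd opprK => sd2.
  by rewrite [LHS]mulr_natl mulr2n {1}sd2 addNr.
have s2z : s (s z) = z by apply/esym/subr0_eq.
have : z ^+ 2 = b ^+ 2 by rewrite -normz s2z.
have zb : s z = z -> z = 0.
  move=> sz; apply/mul2K/mul2K; rewrite -trz0 !sz; ring.
move/eqP; rewrite eqf_sqr => /orP[] /eqP zE.
  by rewrite -zE zb // zE.
by rewrite -[b]opprK -zE zb ?oppr0 // zE rmorphN sb.
Qed.

(** * Degree four: Hilbert 90 and the norm form *)

Lemma half_pred_sqr (n : nat) : odd n -> ((n ^ 2).-1./2 = n.+1 * n.-1./2)%N.
Proof.
move=> n_odd; set k := n.-1./2.
have -> : (n ^ 2).-1 = (n.+1 * k).*2 by rewrite (_ : n = (k * 2)%N.+1); nia.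
exact: doubleK.
Qed.

Lemma pred_exp4 (n : nat) : (0 < n)%N ->
  ((n ^ 4).-1 = n.-1 * (n.+1 * (n ^ 2).+1))%N.
Proof. case: n => // n _ /=; nia. Qed.

Section QuarticExtension.

Variables (K : finFieldType) (L : fieldExtType K).
Local Notation q := #|K|.
Hypothesis q_odd : odd q.
Hypothesis dimL : \dim {:L} = 4%N.

Let q_gt1 : (1 < q)%N := finNzRing_gt1 K.

Lemma ext_exp_eqN1 (j : nat) : (0 < j)%N -> (j * 2 %| (q ^ 4).-1)%N ->
  exists x : L, x ^+ j = -1.
Proof.
move=> j_gt0 dvd_j; have := @finField_exp_eqN1 (FinFieldExtType L) j j_gt0.
by rewrite card_FinFieldExt dimL => /(_ dvd_j).
Qed.

Lemma ext_sqrP (x : L) : x ^+ ((q ^ 4).-1./2) = 1 -> exists y, x = y ^+ 2.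
Proof.
have := @finField_sqrP (FinFieldExtType L) x.
by rewrite card_FinFieldExt dimL oddX q_odd; apply.
Qed.

Lemma trace_quartic (x : L) :
  trace x = x + x ^+ q + x ^+ (q ^ 2) + x ^+ (q ^ 3).
Proof. by rewrite trace_frobenius dimL !big_ord_recr big_ord0 /= add0r. Qed.

Lemma expf_quartic (x : L) : x ^+ (q ^ 4) = x.
Proof. by rewrite -dimL expf_card_ext. Qed.

Lemma ext_nat2_neq0 : (2 : L) != 0.
Proof.
rewrite -(rmorph_nat (in_alg L)) fmorph_eq0; exact: finField_nat2_neq0.
Qed.

(** The element [x = 1 + y^-1] is sent to [1 + y = y * x]. It vanishes only for [y = -1], where a
    solution of [x^(q^2-1) = -1] serves instead. *)
Lemma hilbert90_quartic (y : L) : y * y ^+ (q ^ 2) = 1 ->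
  exists2 x, x != 0 & x ^+ (q ^ 2) = y * x.
Proof.
have [s sE] := frobenius_rmorphism L.
have s2E x : x ^+ (q ^ 2) = s (s x) by rewrite !sE -exprM.
rewrite s2E => yE.
have y_neq0 : y != 0.
  by apply: contra_eq_neq yE => ->; rewrite mul0r eq_sym oner_neq0.
have [y1|yN1] := eqVneq y (-1).
  have [||x xE] := @ext_exp_eqN1 (q ^ 2).-1.
  - lia.
  - have -> : (q ^ 4).-1 = ((q ^ 2).-1 * (q ^ 2).+1)%N by nia.
    rewrite dvdn_pmul2l; last by lia.
    by rewrite dvdn2 /= oddX q_odd.
  exists x.
    apply: contra_eq_neq xE => ->; rewrite expr0n gtn_eqF; last by lia.
    by rewrite eq_sym oppr_eq0 oner_neq0.
  by rewrite -(@prednK (q ^ 2)) ?exprSr ?xE ?y1 //; lia.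
exists (1 + y^-1).
  apply: contra yN1; rewrite addrC addr_eq0 => /eqP yV.
  by rewrite -[y]invrK yV invrN invr1.
have syE : s (s y) = y^-1 by rewrite -[LHS]mul1r -(mulVf y_neq0) -mulrA yE mulr1.
by rewrite s2E !rmorphD !rmorph1 !fmorphV syE invrK mulrDr mulr1 mulfV // addrC.
Qed.

(* The solutions of z * z^(q^2) = N with z + z^(q^2) = w are (w +- D) / 2 with
   D^2 = w^2 - 4N and D^(q^2) = -D; such a D exists unless w^2 - 4N is a nonzero
   square in F_(q^2). *)
Lemma norm_form_half_power (N w : L) : w ^+ (q ^ 2) = w -> N ^+ (q ^ 2) = N ->
    (forall z : L, z * z ^+ (q ^ 2) = N -> z + z ^+ (q ^ 2) != w) ->
  (w ^+ 2 - 4 * N) ^+ ((q ^ 2).-1./2) = 1.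
Proof.
move=> wq Nq no_z; set e := w ^+ 2 - 4 * N.
have [s sE] := frobenius_rmorphism L.
have s2E x : x ^+ (q ^ 2) = s (s x) by rewrite !sE -exprM.
have two_neq0 := ext_nat2_neq0.
have q2_odd : odd (q ^ 2) by rewrite oddX q_odd.
have no_D (D : L) : D ^+ 2 = e -> D ^+ (q ^ 2) != - D.
  move=> De; apply/eqP=> Dq.
  have zq : ((w + D) / 2) ^+ (q ^ 2) = (w - D) / 2.
    by rewrite s2E !rmorphM !rmorphD !fmorphV !rmorph_nat -!s2E wq Dq.
  have /no_z : (w + D) / 2 * ((w + D) / 2) ^+ (q ^ 2) = N.
    have NE : 4 * N = w ^+ 2 - D ^+ 2 by rewrite De /e; ring.
    have four_neq0 : (4 : L) != 0 by rewrite -[4%N]/(2 * 2)%N natrM mulf_neq0.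
    by apply: (mulfI four_neq0); rewrite zq NE; field.
  by rewrite zq; case/eqP; field.
have e_neq0 : e != 0.
  apply/eqP=> e0; have := no_D 0; rewrite e0 expr0n oppr0 expr0n.
  by case: (q ^ 2)%N (q2_odd) => //= n _ /(_ erefl); rewrite eqxx.
have e_q2 : e ^+ (q ^ 2) = e.
  by rewrite s2E /e !rmorphB !rmorphXn !rmorphM !rmorph_nat -!s2E wq Nq.
have q2E : (q ^ 2)%N = ((q ^ 2).-1./2 * 2)%N.+1 by lia.
have e1 : e ^+ (q ^ 2).-1 = 1.
  by apply: (mulfI e_neq0); rewrite mulr1 -exprS prednK //; lia.
have : (e ^+ (q ^ 2).-1./2) ^+ 2 = 1 ^+ 2.
  rewrite expr1n -exprM -e1; congr (_ ^+ _); lia.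
move/eqP; rewrite eqf_sqr => /orP[/eqP//|/eqP eN1].
(* As [(q^4-1)/2 = (q^2+1) (q^2-1)/2] with [q^2+1] even, [e] is a square in [L]; the half power -1
   then gives [D^(q^2) = - D]. *)
have [D De] : exists D, e = D ^+ 2.
  apply: ext_sqrP; rewrite (expnM q 2 2) half_pred_sqr // mulnC exprM eN1.
  by rewrite -signr_odd /= q2_odd.
case/eqP: (no_D _ (esym De)).
by rewrite q2E exprS mulnC exprM -De eN1 mulrN1.
Qed.

(** The necessity of the conditions, with [z] in place of [a1 x^(q^2-1)] and [t] in place of
    [-Tr a0]. Coordinates of F_(q^2) over F_q reduce it to a quartic over [K]. *)
Lemma sqr_of_no_norm_trace (N t : L) : N != 0 -> N ^+ (q ^ 2) = N -> t ^+ q = t ->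
    (forall z : L, z * z ^+ (q ^ 2) = N -> trace z != t) ->
  (exists b : K, b != 0 /\ N = (in_alg L b) ^+ 2) /\ t = 0.
Proof.
move=> N_neq0 Nq tq no_z.
have [s sE] := frobenius_rmorphism L.
have s2E x : x ^+ (q ^ 2) = s (s x) by rewrite !sE -exprM.
have two_neq0 := ext_nat2_neq0.
have twoK_neq0 := finField_nat2_neq0 q_odd.
set m := q.-1./2; have qE : q = (m * 2).+1 by rewrite /m; lia.
pose j : {rmorphism K -> L} := in_alg L.
have sj b : s (j b) = j b.
  by rewrite sE -rmorphXn expf_card.
(* [1, dl] serves as a basis of F_(q^2) over F_q with [s dl = - dl]; its square [d] is a nonsquare
   of [K]. *)
have [||dl dlE] := @ext_exp_eqN1 q.-1.
- by lia.
- rewrite pred_exp4 ?(ltnW q_gt1) //.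
  rewrite dvdn_pmul2l; last by lia.
  by rewrite dvdn_mulr // dvdn2 /= q_odd.
have sdl : s dl = - dl.
  by rewrite sE -(@prednK q) ?exprSr ?dlE ?mulN1r //; lia.
have dl_neq0 : dl != 0.
  apply: contra_eq_neq dlE => ->; rewrite expr0n gtn_eqF; last by lia.
  by rewrite eq_sym oppr_eq0 oner_neq0.
have fixP x : s x = x -> exists b, x = j b.
  by rewrite sE; apply: frobenius_fixed.
have [d dE] : exists d, dl ^+ 2 = j d.
  by apply: fixP; rewrite rmorphXn sdl sqrrN.
have [t' tE] : exists b, t / 2 = j b.
  by apply: fixP; rewrite fmorph_div rmorph_nat sE tq.
have [n0 n0E] : exists b, (N + s N) / 2 = j b.
  apply: fixP; rewrite fmorph_div rmorph_nat rmorphD -s2E Nq; congr (_ / _).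
  exact: addrC.
have [n1 n1E] : exists b, (N - s N) / (2 * dl) = j b.
  apply: fixP; rewrite fmorph_div rmorphB rmorphM rmorph_nat -s2E Nq sdl.
  by rewrite mulrN invrN mulrN -mulNr opprB.
have NE : N = j n0 + dl * j n1.
  by rewrite -n0E -n1E; field; rewrite dl_neq0 two_neq0.
have d_neq0 : d != 0.
  by rewrite -(fmorph_eq0 j) -dE expf_neq0.
have dm : d ^+ m = -1.
  apply: (fmorph_inj j); rewrite rmorphXn -dE -exprM rmorphN1 -dlE.
  congr (_ ^+ _); lia.
(* [G u] is the norm to [K] of [w^2 - 4N] at [w = t' + u dl], an element with [w + s w = t]. *)
pose G u := (d * u ^+ 2 + t' ^+ 2 - 4 * n0) ^+ 2 - d * (2 * t' * u - 4 * n1) ^+ 2.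
have Gm u : G u ^+ m = 1.
  pose w := j t' + dl * j u.
  have sw : s w = j t' - dl * j u.
    by rewrite /w rmorphD rmorphM !sj sdl mulNr.
  have s2w : s (s w) = w.
    by rewrite sw rmorphB rmorphM !sj sdl /w; ring.
  have /norm_form_half_power : w ^+ (q ^ 2) = w by rewrite s2E.
  move=> /(_ _ Nq) e1; set e := w ^+ 2 - 4 * N in e1.
  have eE : e = j (d * u ^+ 2 + t' ^+ 2 - 4 * n0) + dl * j (2 * t' * u - 4 * n1).
    rewrite /e NE /w !(rmorphB, rmorphD, rmorphM, rmorphXn, rmorph_nat) -dE.
    by ring.
  have seE : s e = j (d * u ^+ 2 + t' ^+ 2 - 4 * n0) - dl * j (2 * t' * u - 4 * n1).
    by rewrite eE rmorphD rmorphM !sj sdl mulNr.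
  have normE : e * s e = j (G u).
    by rewrite seE eE /G [RHS]rmorphB (rmorphM _ d) -dE !rmorphXn; ring.
  (* Since [(q^2-1)/2 = (q+1) m], the half power of [e] is the [m]-th power of its norm. *)
  apply: (fmorph_inj j); rewrite rmorphXn -normE rmorph1 sE -exprS -exprM.
  rewrite -[RHS]e1; first by rewrite half_pred_sqr.
  move=> z /no_z; apply: contra_neq => zw.
  rewrite trace_quartic.
  have -> : z + z ^+ q + z ^+ (q ^ 2) + z ^+ (q ^ 3) =
      (z + z ^+ (q ^ 2)) + s (z + z ^+ (q ^ 2)).
    by rewrite rmorphD !sE -exprM -expnSr; ring.
  by rewrite zw sw -[t](divfK two_neq0) tE /w; ring.
(* The coefficients are those of [G u / d ^+ 2], which is monic; dividing by a square keeps the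
   [m]-th powers equal to 1. *)
have [C0 BD] : 16 * t' * n1 / d = 0 /\
    (-2 * (t' ^+ 2 + 4 * n0) / d) ^+ 2 =
    4 * (((t' ^+ 2 - 4 * n0) ^+ 2 - 16 * d * n1 ^+ 2) / d ^+ 2).
  apply: quartic_of_sqr_values => // u.
  have -> : u ^+ 4 + -2 * (t' ^+ 2 + 4 * n0) / d * u ^+ 2 + 16 * t' * n1 / d * u
      + ((t' ^+ 2 - 4 * n0) ^+ 2 - 16 * d * n1 ^+ 2) / d ^+ 2 = G u / d ^+ 2.
    by rewrite /G; field.
  by rewrite expr_div_n Gm -exprM mulnC exprM dm sqrrN expr1n divr1.
have mul2K (x : K) : 2 * x = 0 -> x = 0.
  by move/eqP; rewrite mulf_eq0 (negPf twoK_neq0) => /eqP.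
have tn1 : t' * n1 = 0.
  apply/mul2K/mul2K/mul2K/mul2K; move/(congr1 ( *%R^~ d)): C0.
  by rewrite divfK // mul0r => <-; ring.
have tn0 : t' ^+ 2 * n0 + d * n1 ^+ 2 = 0.
  (* Cleared of denominators, [BD] is 64 times the goal. *)
  do 6!apply/mul2K; move/(congr1 ( *%R^~ (d ^+ 2))): BD => BD.
  have BD' : 4 * (t' ^+ 2 + 4 * n0) ^+ 2 = 4 * ((t' ^+ 2 - 4 * n0) ^+ 2 - 16 * d * n1 ^+ 2).
    by move: BD; rewrite mulrA divfK ?expf_neq0 // => <-; field.
  by move/eqP: BD'; rewrite -subr_eq0 => /eqP <-; ring.
have n1_0 : n1 = 0.
  move/eqP: tn1; rewrite mulf_eq0 => /orP[] /eqP // t'0.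
  move/eqP: tn0; rewrite t'0 expr0n mul0r add0r mulf_eq0 (negPf d_neq0) /=.
  by rewrite expf_eq0 => /eqP.
have n0_neq0 : n0 != 0.
  by apply: contra_neq N_neq0 => n0_0; rewrite NE n0_0 n1_0 !rmorph0 mulr0 addr0.
have t'0 : t' = 0.
  move/eqP: tn0; rewrite n1_0 expr0n mulr0 addr0 mulf_eq0 (negPf n0_neq0) orbF.
  by rewrite expf_eq0 => /eqP.
split; last by rewrite -[t](divfK two_neq0) tE t'0 rmorph0 mul0r.
have n0m : n0 ^+ m = 1.
  have : (n0 ^+ m) ^+ 2 = 1 ^+ 2.
    apply: (mulfI n0_neq0); rewrite expr1n mulr1 -exprM -exprS -qE.
    exact: expf_card.
  move/eqP; rewrite eqf_sqr => /orP[/eqP//|/eqP n0m].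
  (* If [n0 ^+ m = -1], the quotient of the nonsquares [n0] and [d] is a square [v ^+ 2], and [G]
     vanishes at [2 * v], against [Gm]. *)
  have [|v vE] := @finField_sqrP _ (n0 / d) q_odd.
    by rewrite expr_div_n n0m dm divff // oppr_eq0 oner_neq0.
  have := Gm (2 * v); have -> : G (2 * v) = 0.
    rewrite /G t'0 n1_0 (_ : d * _ = 4 * (d * v ^+ 2)); last by ring.
    by rewrite -vE mulrC; field.
  by rewrite expr0n gtn_eqF ?eqxx; [move/eqP; rewrite eq_sym oner_eq0|rewrite /m; lia].
have [b bE] := finField_sqrP q_odd n0m.
exists b; split; last by rewrite NE n1_0 rmorph0 mulr0 addr0 bE rmorphXn.
by apply: contra_neq n0_neq0 => b0; rewrite bE b0 expr0n.
Qed.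

End QuarticExtension.

(** * The root criterion *)

Theorem theorem3p4 (p k q : nat) (p_prime : prime p) (p_odd : odd p)
    (k_gt0 : (0 < k)%N) (q_def : q = (p ^ k)%N)
    (Fq : finFieldType) (card_Fq : #|Fq| = q)
    (Fq4 : fieldExtType Fq) (dim_Fq4 : \dim {:Fq4} = 4%N)
    (a1 a0 : Fq4) (a1_neq0 : a1 != 0)
    (L : {poly Fq4}) (L_def : L = a1 *: 'X^(q ^ 2) + a0 *: 'X) :
  (~ exists x : Fq4, x != 0 /\ trace (L.[x] / x) = 0) <->
  (exists b : Fq, b != 0 /\ a1 ^+ (q ^ 2 + 1) = (b%:A) ^+ 2) /\ trace a0 = 0.
Proof.
have q_odd : odd #|Fq| by rewrite card_Fq q_def oddX p_odd orbT.
rewrite -card_Fq in L_def *.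
have [s sE] := frobenius_rmorphism Fq4.
have s2E (x : Fq4) : x ^+ (#|Fq| ^ 2) = s (s x) by rewrite !sE -exprM.
have s4 x : s (s (s (s x))) = x.
  by rewrite -!s2E -exprM -expnD expf_quartic.
have trE (x : Fq4) : trace x = x + s x + s (s x) + s (s (s x)).
  by rewrite trace_quartic // (expnSr _ 2) exprM -!sE s2E.
have trD (x y : Fq4) : trace (x + y) = trace x + trace y.
  by rewrite !trE !rmorphD; ring.
have LE x : x != 0 -> L.[x] / x = a1 * (s (s x) / x) + a0.
  by move=> x_neq0; rewrite L_def !hornerE -s2E mulrDl mulfK // mulrA.
rewrite addn1 exprS s2E; set N := a1 * s (s a1).
have N_neq0 : N != 0 by rewrite mulf_neq0 ?fmorph_eq0.
split=> [no_root|[[b [b_neq0 NE]] tr0] [x [x_neq0]]].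
  have [||||Nsqr /eqP] := @sqr_of_no_norm_trace _ _ q_odd dim_Fq4 N (- trace a0).
  - exact: N_neq0.
  - by rewrite s2E !rmorphM s4 mulrC.
  - by rewrite -sE rmorphN trE !rmorphD s4; ring.
  (* A [z] of norm [N] makes [z / a1] of norm 1, so Hilbert 90 yields [x] with [L(x)/x = z + a0], of
     trace 0. *)
  - move=> z zN; apply/eqP=> trz; case: no_root.
    have [|x x_neq0 xE] := @hilbert90_quartic _ _ q_odd dim_Fq4 (z / a1).
      rewrite s2E !fmorph_div mulf_div -s2E zN /N divff //.
    exists x; split=> //.
    by rewrite LE // -s2E xE mulfK // mulrC divfK // trD trz addNr.
  by rewrite oppr_eq0 => /eqP.
rewrite LE // trD tr0 addr0 => /eqP; apply/negP; rewrite trE.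
(* Here [z = a1 x^(q^2) / x], and [z z^(q^2) = N = b^2]. *)
apply: (@sqr_norm_trace_neq0 _ s _ (in_alg Fq4 b)) => //.
- exact: ext_nat2_neq0.
- by rewrite sE -rmorphXn expf_card.
- by rewrite fmorph_eq0.
rewrite -[RHS]NE !rmorphM !fmorphV s4 /N; field.
by rewrite !fmorph_eq0 x_neq0.
Qed.
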